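(* For each integer $n\geq 0$, \[\nu_2\bigl(B^{\pm}(24n+2)\bigr)=\nu_2(n)+5.\]
   Context: $S(n,k)$ denotes the Stirling numbers of the second kind, and $B^{\pm}(n)=\sum_{k=0}^n(-1)^kS(n,k)$ (so $B^{\pm}(2)=0$). For a nonzero integer $a$, $\nu_2(a)$ is the exponent of the largest power of $2$ dividing $a$, and $\nu_2(0)=\infty$ (so both sides are $\infty$ when $n=0$). *)

(* Defs.v *)
From HB Require Import structures.
From mathcomp Require Import all_boot all_order all_algebra.
From mathcomp Require Import constructive_ereal.

Set Implicit Arguments.
Unset Strict Implicit.
Unset Printing Implicit Defensive.

Local Open Scope ring_scope.

Definition stirling2 (n k : nat) : nat :=
  #|[set P : {set {set 'I_n}} | partition P [set: 'I_n] & #|P| == k]|.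

Definition compl_bell (n : nat) : int :=
  \sum_(0 <= k < n.+1) (-1) ^+ k * (stirling2 n k)%:Z.

(* The zero case must be separated: logn 2 0 = 0, whereas nu_2(0) is infinite. *)
Definition nu2 (a : int) : \bar int :=
  if a == 0 then +oo%E else (logn 2 `|a|%N)%:Z%:E.

(* Main.v *)
Require Import Defs.
From HB Require Import structures.
From mathcomp Require Import all_boot all_order all_algebra.
From mathcomp Require Import constructive_ereal.
From mathcomp Require Import zify ring.

(** Write [b n] for [compl_bell n] and let [L] be the linear form on [Z[x]] with
    [L (x ^ n) = b n]. Removing the block of a fixed point from a set partition
    gives [b n.+1 = - \sum_k 'C(n, k) b k], that is [L (x f(x)) = - L (f(x+1))].
    Hence, with [t = x^2 - x - 1], [L (t f) = L (f(x+2) - f(x))]: a factor [t]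
    is traded for a difference with step 2, and [t(x+2) - t(x)] is even, so
    [L (t^a g)] is divisible by [2^ceil(a/2)].

    Modulo 2, [x^3 - 1] is a multiple of [t], and squaring three times puts
    [u = x^24 - 1] in the ideal [(t^2, 2)^3]; therefore [2^(3k)] divides
    [c k = L (x^2 u^k)]. Expanding [x^2 (1 + u)^n] gives
    [b (24 n + 2) = \sum_k 'C(n, k) c k]. Here [c 0 = b 2 = 0], [c 1 = b 26] is
    [32] modulo [64], [c 2 = b 50 - 2 b 26] is divisible by [128], and for
    [k >= 2] the identity [k 'C(n, k) = n 'C(n-1, k-1)] bounds the valuation of
    the [k]-th term below by [nu_2 n + 6]; so the term [n * c 1] decides. *)

Set Implicit Arguments.
Unset Strict Implicit.
Unset Printing Implicit Defensive.

Import Order.TTheory GRing.Theory Num.Theory.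
Local Open Scope ring_scope.

(** * Signed counts of set partitions and their recurrence *)

Section SignedPartitions.
Variable T : finType.
Implicit Types (A C D : {set T}) (P Q : {set {set T}}) (x : T).

Definition signed_partitions D : int := \sum_(P | partition P D) (-1) ^+ #|P|.

Lemma leq_card_partition P D : partition P D -> (#|P| <= #|D|)%N.
Proof.
move=> partP; rewrite (card_partition partP) -sum1_card.
by apply: leq_sum => A /(partition_neq0 partP); rewrite card_gt0.
Qed.

Lemma signed_partitions0 : signed_partitions set0 = 1.
Proof.
rewrite /signed_partitions (big_pred1 set0) ?cards0 // => P.
exact: partition_set0.
Qed.

(** Adding the block [D :\: C] is inverse to removing the block of [x]. The right-hand side has the
    shape of the side conditions left by [reindex_onto]. *)
Lemma partition_delete_block D C x Q : x \in D -> C \subset D :\ x ->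
  partition Q C =
  [&& partition (D :\: C |: Q) D, D :\: pblock (D :\: C |: Q) x == C
    & (D :\: C |: Q) :\ (D :\: C) == Q].
Proof.
move=> xD; rewrite subsetD1 => /andP[sCD xC]; set A := D :\: C.
have xA : x \in A by rewrite inE xC.
have defC : D :\: A = C by rewrite setDDr setDv set0U (setIidPr sCD).
apply/idP/and3P => [partQ | [partP _ /eqP <-]].
  have A'Q : A \notin Q.
    by apply: contra xC => /(partitionS partQ)/subsetP/(_ x xA).
  have partP : partition (A |: Q) D.
    rewrite -(setID D C) (setIidPr sCD) [C :|: _]setUC; apply: partitionU1 => //.
      by apply/set0Pn; exists x.
    by rewrite -setI_eq0 /A setDE -setIA [~: C :&: C]setIC setICr setI0.
  split=> //; last by rewrite setU1K.
  by rewrite (def_pblock (partition_trivIset partP) _ xA) ?setU11 ?defC.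
rewrite -[X in partition _ X]defC; apply: partitionD1 => //.
exact: setU11.
Qed.

(** Partitions are grouped by the complement [C] of the block of [x]; removing that block flips the
    sign. *)
Lemma signed_partitions_rec D x : x \in D ->
  signed_partitions D = - \sum_(C : {set T} | C \subset D :\ x) signed_partitions C.
Proof.
move=> xD; rewrite /signed_partitions.
rewrite (partition_big (fun P => D :\: pblock P x)
                       (fun C => C \subset D :\ x)) /=; last first.
  move=> P partP; rewrite subsetD1 subsetDl !inE mem_pblock.
  by rewrite (cover_partition partP) xD.
rewrite -sumrN; apply: eq_bigr => C sCD.
rewrite (reindex_onto (fun Q => D :\: C |: Q) (fun P => P :\ (D :\: C))) /=;
  last first.
  move=> P /andP[partP /eqP defC]; rewrite -defC setDDr setDv set0U.
  have PP : pblock P x \in P by rewrite pblock_mem // (cover_partition partP).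
  by rewrite (setIidPr (partitionS partP PP)) setD1K.
rewrite -sumrN; apply: eq_big => [Q|Q].
  by rewrite (partition_delete_block Q xD sCD) andbA.
rewrite -andbA -partition_delete_block // => partQ.
rewrite cardsU1 exprD; suff -> : D :\: C \notin Q by rewrite expr1 mulN1r.
apply/negP => /(partitionS partQ)/subsetP/(_ x); rewrite inE xD andbT.
by move: sCD; rewrite subsetD1 => /andP[_ /negPf->] /(_ isT).
Qed.

End SignedPartitions.

(** Keeping [f] abstract lets this serve inside the induction proving that signed counts depend only
    on cardinality. *)
Lemma signed_partitions_binomial (T : finType) (D : {set T}) n (f : nat -> int) :
    #|D| = n.+1 ->
    (forall C : {set T}, (#|C| <= n)%N -> signed_partitions C = f #|C|) ->
  signed_partitions D = - \sum_(k < n.+1) 'C(n, k)%:Z * f k.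
Proof.
move=> cardD fE; have /card_gt0P[x xD] : (0 < #|D|)%N by rewrite cardD.
have cardDx : #|D :\ x| = n by move: cardD; rewrite (cardsD1 x) xD => -[].
rewrite (signed_partitions_rec xD); congr (- _).
rewrite (partition_big (fun C : {set T} => inord #|C| : 'I_n.+1) predT) //=.
apply: eq_bigr => k _; rewrite -[n in 'C(n, k)]cardDx -cards_draws.
rewrite -sum1_card -natz natr_sum mulr_suml.
have leC (C : {set T}) : C \subset D :\ x -> (#|C| <= n)%N.
  by rewrite -cardDx => /subset_leq_card.
apply: eq_big => [C|C /andP[sCD /eqP<-]]; last first.
  by rewrite mul1r inordK ?ltnS ?leC // fE ?leC.
rewrite inE; apply: andb_id2l => /leC leCn.
by rewrite -val_eqE /= inordK.
Qed.

Lemma compl_bellE n : compl_bell n = signed_partitions [set: 'I_n].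
Proof.
rewrite /compl_bell big_mkord /signed_partitions.
rewrite [RHS](partition_big
  (fun P : {set {set 'I_n}} => inord #|P| : 'I_n.+1) predT) //=.
apply: eq_bigr => k _; rewrite /stirling2 -sum1_card -natz natr_sum mulr_sumr.
have leP (P : {set {set 'I_n}}) : partition P [set: 'I_n] -> (#|P| <= n)%N.
  by move/leq_card_partition; rewrite cardsT card_ord.
apply: eq_big => [P|P]; last by rewrite mulr1 inE => /andP[_ /eqP->].
rewrite inE; apply: andb_id2l => /leP lePn.
by rewrite -val_eqE /= inordK.
Qed.

Lemma compl_bell0 : compl_bell 0 = 1.
Proof.
rewrite compl_bellE (_ : [set: 'I_0] = set0) ?signed_partitions0 //.
by apply/setP=> -[].
Qed.

Lemma signed_partitions_card (T : finType) (D : {set T}) :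
  signed_partitions D = compl_bell #|D|.
Proof.
move En : #|D| => n; elim/ltn_ind: n => -[|n] IHn in T D En *.
  by rewrite (cards0_eq En) signed_partitions0 compl_bell0.
rewrite compl_bellE.
by rewrite !(@signed_partitions_binomial _ _ n compl_bell) ?cardsT ?card_ord //
  => C leC; exact: IHn.
Qed.

Lemma compl_bellS n :
  compl_bell n.+1 = - \sum_(k < n.+1) 'C(n, k)%:Z * compl_bell k.
Proof.
rewrite compl_bellE; apply: signed_partitions_binomial.
  by rewrite cardsT card_ord.
by move=> C _; exact: signed_partitions_card.
Qed.

(** * The linear form with moments [compl_bell] *)

Definition umbral (p : {poly int}) : int := \sum_(i < size p) p`_i * compl_bell i.

Lemma umbral_widen n (p : {poly int}) : (size p <= n)%N ->
  umbral p = \sum_(i < n) p`_i * compl_bell i.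
Proof.
move=> le_p_n; rewrite /umbral (big_ord_widen _ (fun i => p`_i * compl_bell i) le_p_n).
rewrite big_mkcond; apply: eq_bigr => i _; case: ltnP => // le_p_i.
by rewrite nth_default // mul0r.
Qed.

Lemma umbral_is_scalar : scalar umbral.
Proof.
move=> a p q /=; pose n := maxn (size p) (size q).
have le_n : (size (a *: p + q)%R <= n)%N.
  apply: leq_trans (size_polyD _ _) _.
  by rewrite geq_max leq_maxr andbT (leq_trans (size_scale_leq _ _)) ?leq_maxl.
rewrite (umbral_widen le_n) (@umbral_widen n p) ?leq_maxl //.
rewrite (@umbral_widen n q) ?leq_maxr // mulr_sumr -big_split /=.
by apply: eq_bigr => i _; rewrite coefD coefZ mulrDl mulrA.
Qed.

HB.instance Definition _ :=
  GRing.isLinear.Build int {poly int} int *%R umbral umbral_is_scalar.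

Lemma umbralXn n : umbral 'X^n = compl_bell n.
Proof.
rewrite /umbral size_polyXn big_ord_recr /= big1 ?coefXn ?eqxx ?mul1r ?add0r //.
by move=> i _; rewrite coefXn ltn_eqF ?mul0r.
Qed.

Lemma umbral_natl n p : umbral (n%:R * p) = n%:R * umbral p.
Proof. by rewrite !mulr_natl raddfMn. Qed.

Lemma umbral_mulX p : umbral ('X * p) = - umbral (p \Po ('X + 1)).
Proof.
rewrite -[p in LHS]coefK poly_def mulr_sumr comp_polyE !linear_sum -sumrN /=.
apply: eq_bigr => i _; rewrite -scalerAr -exprS !linearZ /= umbralXn -mulrN.
congr (_ * _); rewrite compl_bellS addrC exprDn linear_sum; congr (- _).
by apply: eq_bigr => k _; rewrite expr1n mul1r raddfMn /= umbralXn -mulr_natl natz.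
Qed.

(** * Computation of [compl_bell] modulo 128 *)

(* The values [umbral ('X^i * ('X + 1) ^+ j)] form an analogue of the Bell
   triangle: antidiagonal [n] lists those with [i + j = n] by increasing [j]. *)
Definition triangle_next (s : seq int) : seq int :=
  let y := (- last 0 s %% 128)%Z in
  y :: scanl (fun a b => (a + b) %% 128)%Z y s.

Definition triangle_entry i j : int :=
  (umbral ('X^i * ('X + 1) ^+ j)%R %% 128)%Z.

Lemma triangle_scanl n j m : (j + m <= n.+1)%N ->
  scanl (fun a b => (a + b) %% 128)%Z (triangle_entry (n.+1 - j) j)
    [seq triangle_entry (n - k) k | k <- iota j m]
  = [seq triangle_entry (n.+1 - k) k | k <- iota j.+1 m].
Proof.
elim: m j => //= m IHm j; rewrite addnS ltnS => le_jm.
(* Splitting one factor as ['X + 1] makes each entry the sum of its left neighbour and the entry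
   above that neighbour. *)
suff E : ((triangle_entry (n.+1 - j) j + triangle_entry (n - j) j) %% 128)%Z
   = triangle_entry (n.+1 - j.+1) j.+1 by rewrite E IHm ?addSn.
rewrite modzDm -raddfD /= subSS subSn ?(leq_trans (leq_addr _ _) le_jm) //.
by congr (umbral _ %% _)%Z; rewrite !exprS; ring.
Qed.

Lemma iter_triangle_next n :
  iter n triangle_next [:: 1] = [seq triangle_entry (n - k) k | k <- iota 0 n.+1].
Proof.
elim: n => [|n IHn].
  by rewrite /= /triangle_entry subn0 !expr0 mul1r -(expr0 'X) umbralXn compl_bell0.
rewrite iterS IHn /triangle_next.
(* By [umbral_mulX], ['X^n.+1] has the opposite value to [('X + 1) ^+ n], the last entry of
   antidiagonal [n]. *)
have -> : (- last 0 [seq triangle_entry (n - k) k | k <- iota 0 n.+1] %% 128)%Z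
   = triangle_entry (n.+1 - 0) 0.
  rewrite -nth_last size_map size_iota succnK (nth_map 0%N) ?size_iota // nth_iota //.
  rewrite add0n subnn subn0 /triangle_entry modzNm expr0 mul1r mulr1 exprS.
  by rewrite umbral_mulX comp_Xn_poly.
by rewrite triangle_scanl.
Qed.

Lemma compl_bell_mod128 n :
  (compl_bell n %% 128)%Z = head 0 (iter n triangle_next [:: 1]).
Proof.
by rewrite iter_triangle_next /= /triangle_entry subn0 expr0 mulr1 umbralXn.
Qed.

Lemma compl_bell26_mod128 : (compl_bell 26 %% 128)%Z = 96.
Proof. by rewrite compl_bell_mod128; vm_compute. Qed.

Lemma compl_bell50_mod128 : (compl_bell 50 %% 128)%Z = 64.
Proof. by rewrite compl_bell_mod128; vm_compute. Qed.

Lemma compl_bell2 : compl_bell 2 = 0.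
Proof.
by rewrite !(compl_bellS, big_ord_recl, big_ord0) compl_bell0.
Qed.

(** * Powers of [tpoly] and 2-divisibility *)

Definition tpoly : {poly int} := 'X^2 - 'X - 1.

Lemma umbral_tpoly_mul p : umbral (tpoly * p) = umbral (p \Po ('X + 2)) - umbral p.
Proof.
(* The first shift turns ['X - 1] into ['X], so [umbral_mulX] applies a second time. *)
have -> : tpoly * p = 'X * (('X - 1) * p) - p by rewrite /tpoly; ring.
rewrite raddfB /= umbral_mulX rmorphM rmorphB rmorph1 /= comp_polyX addrK.
rewrite umbral_mulX opprK -comp_polyA rmorphD rmorph1 /= comp_polyX.
by rewrite -addrA.
Qed.

Lemma comp_poly_add2 (p q r : {poly int}) :
  exists h, p \Po (q + 2 * r) = p \Po q + 2 * h.
Proof.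
elim/poly_ind: p => [|p c [h E]]; first by exists 0; rewrite !rmorph0; ring.
exists ((p \Po q) * r + h * (q + 2 * r)).
by rewrite !(rmorphD, rmorphM) /= !comp_polyC !comp_polyX E; ring.
Qed.

Lemma comp_tpoly : tpoly \Po ('X + 2) = tpoly + 2 * (2 * 'X + 1).
Proof. by rewrite /tpoly !rmorphB rmorphXn rmorph1 /= comp_polyX; ring. Qed.

Lemma dvdz_umbral_tpolyX a g :
  (2 ^+ uphalf a %| umbral (tpoly ^+ a * g)%R)%Z.
Proof.
elim/ltn_ind: a => -[|a] IHa in g *; first by rewrite expr0 dvd1z.
have [h Eh] := comp_poly_add2 g 'X 1.
rewrite mulr1 comp_polyXr in Eh.
rewrite exprS -mulrA umbral_tpoly_mul rmorphM rmorphXn /= comp_tpoly Eh.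
rewrite exprDn big_ord_recl /= subn0 expr0 mulr1 bin0 mulr1n mulrDl.
have -> : tpoly ^+ a * (g + 2 * h) = tpoly ^+ a * g + 2%:R * (tpoly ^+ a * h)
  by ring.
(* The undivided term [tpoly ^+ a * g] cancels in the difference; every remaining term has an
   explicit factor 2. *)
rewrite !raddfD /= -!addrA addrC -!addrA addNr addr0 umbral_natl.
apply: rpredD.
  apply: dvdz_trans (dvdz_mul (dvdzz 2) (IHa a (ltnSn a) h)).
  by rewrite -exprS dvdz_exp2l //; lia.
rewrite mulr_suml raddf_sum; apply: rpred_sum => i _ /=.
rewrite [X in umbral X]mulrnAl raddfMn /= rpredMn // /bump /= add1n exprMn.
have -> : tpoly ^+ (a - i.+1) * (2 ^+ i.+1 * (2 * 'X + 1) ^+ i.+1) * (g + 2 * h)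
  = (2 ^ i.+1)%:R * (tpoly ^+ (a - i.+1) * ((2 * 'X + 1) ^+ i.+1 * (g + 2 * h)))
  by rewrite natrX; ring.
have lt_ia := ltn_ord i.
(* Losing [i.+1] factors [tpoly] costs at most about half as many powers of 2 as the factor
   [2 ^ i.+1] supplies. *)
rewrite umbral_natl natrX.
apply: dvdz_trans (dvdz_mul (dvdzz _) (IHa (a - i.+1)%N _ _)); last by lia.
by rewrite -exprD dvdz_exp2l //; lia.
Qed.

(** * The ideal generated by [tpoly ^+ 2] and 2 *)

(* The [m]-th power of the ideal generated by [tpoly ^+ 2] and [2]. *)
Fixpoint in_ideal_pow m (p : {poly int}) : Prop :=
  if m is m'.+1 then
    exists p1 p2, [/\ in_ideal_pow m' p1, in_ideal_pow m' p2
                    & p = tpoly ^+ 2 * p1 + 2 * p2]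
  else True.

Lemma in_ideal_powD m p q :
  in_ideal_pow m p -> in_ideal_pow m q -> in_ideal_pow m (p + q).
Proof.
elim: m p q => //= m IHm _ _ [p1 [p2 [Hp1 Hp2 ->]]] [q1 [q2 [Hq1 Hq2 ->]]].
by exists (p1 + q1), (p2 + q2); split; [exact: IHm | exact: IHm | ring].
Qed.

Lemma in_ideal_powMr m p q : in_ideal_pow m p -> in_ideal_pow m (p * q).
Proof.
elim: m p => //= m IHm _ [p1 [p2 [Hp1 Hp2 ->]]].
by exists (p1 * q), (p2 * q); split; [exact: IHm | exact: IHm | ring].
Qed.

Lemma in_ideal_powM m n p q :
  in_ideal_pow m p -> in_ideal_pow n q -> in_ideal_pow (m + n) (p * q).
Proof.
elim: m p => [|m IHm] p; first by move=> _; rewrite mulrC; exact: in_ideal_powMr.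
move=> /= [p1 [p2 [Hp1 Hp2 ->]]] Hq.
by exists (p1 * q), (p2 * q); split; [exact: IHm | exact: IHm | ring].
Qed.

Lemma in_ideal_powX m k p : in_ideal_pow m p -> in_ideal_pow (m * k) (p ^+ k).
Proof.
move=> Hp; elim: k => [|k IHk]; first by rewrite muln0.
by rewrite mulnS exprS; exact: in_ideal_powM.
Qed.

Lemma dvdz_umbral_ideal_pow m p :
  in_ideal_pow m p -> (2 ^+ m %| umbral p)%Z.
Proof.
(* The induction must carry the squares of [tpoly] already extracted, each worth one factor 2. *)
suff gen a : in_ideal_pow m p -> (2 ^+ (m + a) %| umbral (tpoly ^+ a.*2 * p)%R)%Z.
  by move/(gen 0%N); rewrite addn0 double0 expr0 mul1r.
elim: m a p => [|m IHm] a p /=.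
  by move=> _; have := dvdz_umbral_tpolyX a.*2 p; rewrite uphalf_double.
move=> [p1 [p2 [Hp1 Hp2 ->]]].
have -> : tpoly ^+ a.*2 * (tpoly ^+ 2 * p1 + 2 * p2)
   = tpoly ^+ a.+1.*2 * p1 + 2%:R * (tpoly ^+ a.*2 * p2).
  by rewrite doubleS !exprS; ring.
rewrite raddfD /= umbral_natl; apply: rpredD.
  by rewrite addSnnS; exact: IHm.
by rewrite addSn exprS; apply: dvdz_mul (dvdzz _) (IHm _ _ Hp2).
Qed.

(** Squaring [y] turns [s = y - 1] into [s * (s + 2)], which gains an ideal power as 2 lies in the
    ideal. Here [y] is ['X^6], then ['X^12]. *)
Lemma X24_sub1_in_ideal_pow3 : in_ideal_pow 3 ('X^24 - 1).
Proof.
pose s1 : {poly int} := 'X^6 - 1; pose s2 : {poly int} := s1 * (s1 + 2).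
have H2 : in_ideal_pow 1 2 by exists 0, 1; split=> //; ring.
have H1 : in_ideal_pow 1 s1.
  (* With [s = 'X^3 - 1] one has [s1 = s ^+ 2 + 2 * s], and
     [s = ('X - 1) * tpoly + 2 * b]. *)
  pose b : {poly int} := ('X - 1) * ('X + 1).
  exists (('X - 1) ^+ 2), (2 * (tpoly * ('X - 1) * b) + 2 * b ^+ 2 + ('X^3 - 1)).
  by split=> //; rewrite /s1 /b /tpoly; ring.
have Hs2 : in_ideal_pow 2 s2.
  by apply: (@in_ideal_powM 1 1) => //; exact: in_ideal_powD.
have -> : 'X^24 - 1 = s2 * (s2 + 2) by rewrite /s2 /s1; ring.
apply: (@in_ideal_powM 2 1) => //; apply: in_ideal_powD => //.
exact: in_ideal_powMr.
Qed.

(** * Binomial expansion and valuations *)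

(** This is the [k]-th forward difference at 0 of the sequence [compl_bell (24 * n + 2)]. *)
Definition mahler_coef k : int := umbral ('X^2 * ('X^24 - 1) ^+ k).

Lemma compl_bell_mahler n :
  compl_bell (24 * n + 2) = \sum_(k < n.+1) 'C(n, k)%:Z * mahler_coef k.
Proof.
have E : 'X^(24 * n + 2) = 'X^2 * (('X^24 - 1) + 1) ^+ n :> {poly int}.
  by rewrite subrK -exprM -exprD addnC.
rewrite -umbralXn E addrC exprDn mulr_sumr raddf_sum; apply: eq_bigr => k _ /=.
by rewrite expr1n mul1r mulrnAr raddfMn /= -mulr_natl natz.
Qed.

Lemma dvdz_mahler_coef k : (2 ^+ (3 * k) %| mahler_coef k)%Z.
Proof.
rewrite /mahler_coef mulrC; apply: dvdz_umbral_ideal_pow.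
apply/in_ideal_powMr/in_ideal_powX; exact: X24_sub1_in_ideal_pow3.
Qed.

Lemma mahler_coef0 : mahler_coef 0 = 0.
Proof. by rewrite /mahler_coef expr0 mulr1 umbralXn compl_bell2. Qed.

Lemma mahler_coef1 : exists z : int, mahler_coef 1 = 2 ^+ 5 * (2 * z + 1).
Proof.
have -> : mahler_coef 1 = compl_bell 26.
  rewrite /mahler_coef expr1 mulrBr mulr1 -exprD raddfB /= !umbralXn.
  by rewrite compl_bell2 subr0.
(* [128 * q + 96 = 32 * (2 * (2 * q + 1) + 1)]. *)
exists ((compl_bell 26 %/ 128)%Z * 2 + 1).
rewrite [LHS](divz_eq _ 128) compl_bell26_mod128; ring.
Qed.

(** The general bound gives only [2 ^+ 6] here, so residues are computed: [64 - 2 * 96 = -128]. *)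
Lemma dvdz_mahler_coef2 : (2 ^+ 7 %| mahler_coef 2)%Z.
Proof.
have -> : mahler_coef 2 = compl_bell 50 - 2%:R * compl_bell 26.
  rewrite /mahler_coef; have -> : 'X^2 * ('X^24 - 1) ^+ 2
     = 'X^50 - 2%:R * 'X^26 + 'X^2 :> {poly int} by ring.
  by rewrite raddfD raddfB /= umbral_natl !umbralXn compl_bell2 addr0.
apply/dvdzP; exists ((compl_bell 50 %/ 128)%Z - 2 * (compl_bell 26 %/ 128)%Z - 1).
rewrite [compl_bell 50 in LHS](divz_eq _ 128) compl_bell50_mod128.
rewrite [compl_bell 26 in LHS](divz_eq _ 128) compl_bell26_mod128; ring.
Qed.

Lemma leq_logn_add_bin n k : (0 < k <= n)%N ->
  (logn 2 n <= logn 2 k + logn 2 'C(n, k))%N.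
Proof.
case: n k => [|n] [|k] // /andP[_ le_kn].
rewrite -lognM ?bin_gt0 // -mul_bin_diag lognM ?bin_gt0 //.
exact: leq_addr.
Qed.

Lemma dvdz_mahler_term n k : (1 < k <= n)%N ->
  (2 ^+ (logn 2 n + 6) %| 'C(n, k)%:Z * mahler_coef k)%Z.
Proof.
move=> /andP[k_gt1 le_kn].
have le_log := @leq_logn_add_bin n k; rewrite (ltnW k_gt1) le_kn in le_log.
have dvdC : (2 ^+ logn 2 'C(n, k) %| 'C(n, k)%:Z)%Z.
  by rewrite dvdzE abszX pfactor_dvdnn.
have [e dvd_e le_e] : exists2 e, (2 ^+ e %| mahler_coef k)%Z
                               & (6 + logn 2 k <= e)%N.
  (* For [k = 2] the exponent needed is 7, above [3 * k]; from [k = 3] on, [3 * k] suffices. *)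
  have [->|k_neq2] := eqVneq k 2%N; first by exists 7%N; [exact: dvdz_mahler_coef2|].
  exists (3 * k)%N; first exact: dvdz_mahler_coef.
  have : (logn 2 k < k)%N by exact/ltn_logl/ltnW.
  by lia.
apply: dvdz_trans (dvdz_mul dvdC dvd_e); rewrite -exprD dvdz_exp2l //.
by have := le_log isT; lia.
Qed.

Theorem theorem6p4 (n : nat) :
  nu2 (compl_bell (24 * n + 2)%N) = (nu2 n%:Z + 5%:E)%E.
Proof.
case: n => [|n]; first by rewrite muln0 add0n compl_bell2 /nu2 eqxx.
set N := n.+1; pose v := logn 2 N.
have [z defB] : exists z : int, compl_bell (24 * N + 2) = 2 ^+ (v + 5) * (2 * z + 1).
  have [c c1E] := mahler_coef1.
  have [m odd_m defN] : exists2 m, odd m & N = (m * 2 ^ v)%N.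
    have [m co2m defN] := pfactor_coprime (isT : prime 2) (ltn0Sn n).
    by exists m; rewrite // -coprime2n.
  have /dvdzP[w wE] : (2 ^+ (v + 6)
      %| \sum_(i < n) 'C(N, i.+2)%:Z * mahler_coef i.+2)%Z.
    apply: rpred_sum => i _; apply: dvdz_mahler_term.
    by have := ltn_ord i; rewrite /N; lia.
  (* With [m = 2 * h + 1], the product [m * (2 * c + 1)] is [2 * (h * (2 * c + 1) + c) + 1]; the
     terms from [k = 2] on add [2 * w]. *)
  exists (m./2%:Z * (2 * c + 1) + c + w).
  rewrite compl_bell_mahler 2!big_ord_recl /= bin0 mahler_coef0 mulr0 add0r.
  rewrite /bump /= !add1n bin1 c1E.
  under eq_bigr do rewrite !add1n.
  rewrite wE defN -[m in LHS]odd_double_half odd_m -muln2 -[Posz _]natz !(natrD, natrM, natrX).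
  by rewrite !natz (_ : Posz true = 1) // !exprD; ring.
have odd_z : coprime 2 `|(2 * z + 1)%R|%N by rewrite coprime2n; lia.
have nz : 2 ^+ (v + 5) * (2 * z + 1) != 0.
  by rewrite mulf_neq0 ?expf_neq0 //; apply: contraTneq odd_z => ->.
by rewrite /nu2 defB (negPf nz) abszM abszX mulnC logn_Gauss // pfactorK.
Qed.
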